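(* Let $m\ge 2$ be an integer, let $S\subset\mathbb{Z}^m$ be any finite set, and let $V(S)$ be the set of lattice points in $\mathbb{Z}^m$ simultaneously visible from $S$. Then $$\lim_{R\to\infty}\frac{|V(S)\cap B_R|}{\mathrm{vol}(B_R)}=\prod_{p\in\mathcal{P}}\left(1-\frac{s(p)}{p^m}\right),$$ where $B_R\subset\mathbb{R}^m$ is the Euclidean ball of radius $R$ centered at the origin.
   Context: $V(S)=\{\mathbf{z}\in\mathbb{Z}^m : \gcd(z_1-x_1,\dots,z_m-x_m)=1\ \text{for all }\mathbf{x}=(x_1,\dots,x_m)\in S\}$. $\mathcal{P}$ is the set of all rational primes; for $p\in\mathcal{P}$, $\pi_p:\mathbb{Z}^m\to(\mathbb{Z}/p\mathbb{Z})^m$ is the natural projection and $s(p)=|\pi_p(S)|$. $\mathrm{vol}$ denotes Lebesgue measure on $\mathbb{R}^m$. *)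

(* Defs.v *)
From HB Require Import structures.
From mathcomp Require Import all_boot all_order all_algebra finmap.
From mathcomp Require Import zify.
From mathcomp Require Import all_classical all_reals all_analysis.
From mathcomp Require Import measurable_realfun.

Set Implicit Arguments.
Unset Strict Implicit.
Unset Printing Implicit Defensive.
Import Order.TTheory GRing.Theory Num.Theory.
Import numFieldNormedType.Exports.

Local Open Scope classical_set_scope.
Local Open Scope ring_scope.

Section lebesgue_measure_tuple.
Variable R : realType.
Local Open Scope ereal_scope.

Definition tuple_of_pair n (x : measurableTypeR R * n.-tuple R)
  : n.+1.-tuple R := [tuple of x.1 :: x.2].

(* The n-fold product of the one-dimensional Lebesgue measure (for n = 0, the
   unit mass on the one-point space). Being a set function it is applied to all
   subsets, but it is meaningful on the measurable (Borel) ones only. *)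
Fixpoint lebesgue_measure_tuple n : set (n.-tuple R) -> \bar R :=
  if n is n'.+1 then
    pushforward (lebesgue_measure \x lebesgue_measure_tuple (n := n'))
      (@tuple_of_pair n')
  else \d_ [tuple].

Let pair_of_tuple n (t : n.+1.-tuple R) : measurableTypeR R * n.-tuple R :=
  (thead t, [tuple of behead t]).

Lemma measurable_tuple_of_pair n : measurable_fun setT (@tuple_of_pair n).
Proof. exact: measurable_cons. Qed.

Let measurable_pair_of_tuple n : measurable_fun setT (@pair_of_tuple n).
Proof.
apply/measurable_fun_pairP; split.
- exact: (measurable_tnth ord0).
- exact: measurable_behead.
Qed.

Let tuple_of_pairK n : cancel (@tuple_of_pair n) (@pair_of_tuple n).
Proof. by move=> [x t]; congr pair => /=; apply/val_inj. Qed.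

Section step.
Variables (n : nat) (mu : {sigma_finite_measure set (n.-tuple R) -> \bar R}).

Let nu := pushforward (lebesgue_measure \x mu) (@tuple_of_pair n).

Let nuM : {measure set (n.+1.-tuple R) -> \bar R} :=
  measure_function_pushforward__canonical__measure_function_Measure
    (lebesgue_measure \x mu) (@measurable_tuple_of_pair n).

HB.instance Definition _ := isMeasure.Build _ _ _ nu
  (measure0 nuM) (measure_ge0 nuM) (@measure_semi_sigma_additive _ _ _ nuM).

Let nu_sigma_finite : sigma_finite setT nu.
Proof.
have /sigma_finiteP[F [TF ndF Foo]] := sigma_finiteT (@lebesgue_measure R).
have /sigma_finiteP[G [TG ndG Goo]] := sigma_finiteT mu.
exists (fun k => @pair_of_tuple n @^-1` (F k `*` G k)).
  apply/esym/seteqP; split => // t _.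
  have [i _ Fi] : (\bigcup_i F i) (thead t) by rewrite -TF.
  have [j _ Gj] : (\bigcup_i G i) [tuple of behead t] by rewrite -TG.
  exists (maxn i j) => //; split => /=.
  - by move: Fi; exact/subsetPset/ndF/leq_maxl.
  - by move: Gj; exact/subsetPset/ndG/leq_maxr.
move=> k; have [mF Fk] := Foo k; have [mG Gk] := Goo k; split.
  rewrite -[X in measurable X]setTI; apply: measurable_pair_of_tuple => //.
  exact: measurableX.
rewrite /nu /pushforward -comp_preimage.
suff -> : @pair_of_tuple n \o @tuple_of_pair n = id.
  rewrite preimage_id product_measure1E//.
  by rewrite lte_mul_pinfty// ge0_fin_numE.
by apply/funext => x; exact: tuple_of_pairK.
Qed.

HB.instance Definition _ := Measure_isSigmaFinite.Build _ _ _ nu nu_sigma_finite.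

#[local] Lemma lebesgue_measure_tuple_step :
  exists m : {sigma_finite_measure set (n.+1.-tuple R) -> \bar R},
    m = nu :> (_ -> _).
Proof. by exists nu. Qed.
End step.

Let lebesgue_measure_tupleP n :
  exists m : {sigma_finite_measure set (n.-tuple R) -> \bar R},
    m = @lebesgue_measure_tuple n :> (_ -> _).
Proof.
elim: n => [|n [m mE]]; first by exists \d_ [tuple].
by rewrite /= -mE; exact: lebesgue_measure_tuple_step.
Qed.

Let lebesgue_measure_tuple0 n : @lebesgue_measure_tuple n set0 = 0.
Proof. by have [m <-] := lebesgue_measure_tupleP n; exact: measure0. Qed.

Let lebesgue_measure_tuple_ge0 n A : 0 <= @lebesgue_measure_tuple n A.
Proof. by have [m <-] := lebesgue_measure_tupleP n; exact: measure_ge0. Qed.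

Let lebesgue_measure_tuple_semi_sigma_additive n :
  semi_sigma_additive (@lebesgue_measure_tuple n).
Proof.
by have [m <-] := lebesgue_measure_tupleP n; exact: measure_semi_sigma_additive.
Qed.

HB.instance Definition _ n := isMeasure.Build _ _ _ (@lebesgue_measure_tuple n)
  (@lebesgue_measure_tuple0 n) (@lebesgue_measure_tuple_ge0 n)
  (@lebesgue_measure_tuple_semi_sigma_additive n).

Let lebesgue_measure_tuple_sigma_finite n :
  sigma_finite setT (@lebesgue_measure_tuple n).
Proof. by have [m <-] := lebesgue_measure_tupleP n; exact: sigma_finiteT. Qed.

HB.instance Definition _ n := Measure_isSigmaFinite.Build _ _ _
  (@lebesgue_measure_tuple n) (@lebesgue_measure_tuple_sigma_finite n).

Lemma lebesgue_measure_tuple_box n (A : 'I_n -> set R) :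
  (forall i, measurable (A i)) ->
  lebesgue_measure_tuple [set t : n.-tuple R | forall i, A i (tnth t i)] =
  \prod_(i < n) lebesgue_measure (A i).
Proof.
elim: n A => [|n IHn] A mA.
  by rewrite big_ord0 /= diracE mem_set//= => -[].
rewrite big_ord_recl -IHn// -product_measure1E.
- rewrite /= /pushforward; congr (product_measure1 _ _ _).
  apply/seteqP; split=> -[x t] /=.
    move=> At; split; first exact: (At ord0).
    by move=> i; have := At (lift ord0 i); rewrite tnthS.
  move=> [Ax At] i; have [j ->|->] := unliftP ord0 i; last exact: Ax.
  by rewrite tnthS; exact: At.
- exact: (mA ord0).
- rewrite (_ : [set _ | _] = \bigcap_(i in [set: 'I_n])
    ((fun t : n.-tuple R => tnth t i) @^-1` A (lift ord0 i))); last first.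
    by apply/seteqP; split => [t At i _|t At i]; [exact: At|exact: (At i)].
  apply: fin_bigcap_measurable => // i _; rewrite -[X in measurable X]setTI.
  exact: measurable_tnth.
Qed.

End lebesgue_measure_tuple.

Section visibility.
Variable m : nat.
Implicit Types (x z : m.-tuple int) (S : {fset m.-tuple int}).

Definition visible S : set (m.-tuple int) :=
  [set z | forall x, x \in S ->
    \big[gcdz/0]_(i < m) (tnth z i - tnth x i) = 1].

(* 'Z_p is Z/pZ only for p > 1; the projection is only used for p prime. *)
Definition proj_mod (p : nat) x : m.-tuple 'Z_p :=
  [tuple of map (fun a : int => a%:~R) x].

Definition num_residues S (p : nat) : nat :=
  #|` [fset proj_mod p x | x in S]%fset|.

Lemma num_residues_le S p : prime p -> (num_residues S p <= p ^ m)%N.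
Proof.
move=> /prime_gt1 p1; rewrite /num_residues.
have <- : #|{: m.-tuple 'Z_p}| = (p ^ m)%N.
  by rewrite card_tuple card_ord Zp_cast.
by rewrite cardfE; exact: leq_card (val_inj).
Qed.

End visibility.

Section density.
Variables (R : realType) (m : nat).
Implicit Types (x : m.-tuple R) (z : m.-tuple int) (S : {fset m.-tuple int}).

Definition eucl_norm x : R := Num.sqrt (\sum_(i < m) tnth x i ^+ 2).

Definition eucl_ball (r : R) : set (m.-tuple R) := [set x | eucl_norm x < r].

Definition real_of_lattice z : m.-tuple R :=
  [tuple of map (fun a : int => a%:~R) z].

(* The number of elements of A in the ball of radius r; [fset_set] is the
   enumeration of a finite set, see [finite_lattice_ball]. *)
Definition count_in_ball (A : set (m.-tuple int)) (r : R) : nat :=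
  #|` fset_set (A `&` real_of_lattice @^-1` eucl_ball r)|.

(* Partial products over the primes p < n; they converge by
   [is_cvg_euler_product], since every factor lies in [0, 1]. *)
Definition euler_product S (n : nat) : R :=
  \prod_(p < n | prime p) (1 - (num_residues S p)%:R / p%:R ^+ m).

Lemma le_eucl_norm x i : `|tnth x i| <= eucl_norm x.
Proof.
rewrite -sqrtr_sqr ler_wsqrtr// (bigD1 i)//= lerDl.
by apply: sumr_ge0 => j _; exact: sqr_ge0.
Qed.

Lemma finite_lattice_ball (A : set (m.-tuple int)) r :
  finite_set (A `&` real_of_lattice @^-1` eucl_ball r).
Proof.
pose N := (Num.truncn r).+1.
pose f (t : m.-tuple 'I_(N + N).+1) : m.-tuple int :=
  [tuple of map (fun k : 'I_(N + N).+1 => (k : nat)%:Z - N%:Z) t].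
apply: (@sub_finite_set _ _ (range f)); last exact: finite_image.
move=> z [_ /= zr].
have zN i : `|tnth z i| < N%:Z.
  rewrite -(ltr_int R) intr_norm.
  have := le_lt_trans (le_eucl_norm (real_of_lattice z) i) zr.
  rewrite tnth_map => /lt_trans; apply.
  exact: truncnS_gt.
pose g i : 'I_(N + N).+1 := inord (absz (tnth z i + N%:Z)).
exists [tuple g i | i < m] => //.
apply: eq_from_tnth => i; rewrite tnth_map tnth_mktuple /g inordK.
  by have := zN i; lia.
by have := zN i; lia.
Qed.

Lemma measurable_eucl_ball r : measurable (eucl_ball r).
Proof.
rewrite -[X in measurable X]setTI.
have mf : measurable_fun setT eucl_norm.
  have ms : measurable_fun setT (fun a : R => Num.sqrt a).
    by apply: continuous_measurable_fun; exact: sqrt_continuous.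
  apply: (measurableT_comp ms).
  apply: measurable_sum => i; apply: measurable_funX; exact: measurable_tnth.
suff -> : eucl_ball r = eucl_norm @^-1` `]-oo, r[ by exact: mf.
by apply/seteqP; split => x /=; rewrite in_itv.
Qed.

Lemma lebesgue_measure_eucl_ball_fin_num r :
  lebesgue_measure_tuple (eucl_ball r) \is a fin_num.
Proof.
rewrite ge0_fin_numE//.
pose box := [set x : m.-tuple R | forall i, `]- r, r[%classic (tnth x i)].
have mbox : measurable box.
  rewrite (_ : box = \bigcap_(i in [set: 'I_m])
    ((fun t : m.-tuple R => tnth t i) @^-1` `]- r, r[)); last first.
    by apply/seteqP; split => [t At i _|t At i]; [exact: At|exact: (At i)].
  apply: fin_bigcap_measurable => // i _; rewrite -[X in measurable X]setTI.
  by apply: measurable_tnth => //; exact: measurable_itv.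
apply: (@le_lt_trans _ _ (lebesgue_measure_tuple box)).
  apply: le_measure; rewrite ?inE//; first exact: measurable_eucl_ball.
  move=> x xr i /=; rewrite in_itv/= -ltr_norml.
  exact: le_lt_trans (le_eucl_norm x i) xr.
rewrite (lebesgue_measure_tuple_box (A := fun=> `]- r, r[%classic))//.
rewrite -ge0_fin_numE; last by apply: prode_ge0.
by apply: prode_fin_num => i _; rewrite lebesgue_measure_itv/=; case: ifPn.
Qed.

Lemma is_cvg_euler_product S : cvgn (euler_product S).
Proof.
have factor p : prime p ->
    0 <= 1 - (num_residues S p)%:R / p%:R ^+ m :> R /\
    1 - (num_residues S p)%:R / p%:R ^+ m <= 1 :> R.
  move=> pp; have p0 : 0 < p%:R ^+ m :> R.
    by rewrite exprn_gt0// ltr0n prime_gt0.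
  rewrite subr_ge0 ler_pdivrMr// mul1r -natrX ler_nat num_residues_le//.
have ge0 n : 0 <= euler_product S n.
  by apply: prodr_ge0 => p /factor[].
apply: nonincreasing_is_cvgn; last by exists 0 => _ [n _ <-].
apply/nonincreasing_seqP => n; rewrite /euler_product big_mkcond big_ord_recr/=.
rewrite -big_mkcond/=; case: ifPn => [/factor[_ ?]|_]; last by rewrite mulr1.
by apply: ler_piMr => //; exact: ge0.
Qed.

End density.

Arguments eucl_ball {R} m r.

(* Main.v *)
(* Sieving. A point is visible from S exactly when it avoids the residues of S
   modulo every prime. Keeping only the primes up to k gives a set that is
   periodic modulo their product Q; by the Chinese remainder theorem it has
   Q^m times the partial Euler product residues, and tiling space by cubes of
   side Q shows that its density in large balls is that partial product. The
   points lost by restricting to primes up to k are congruent to some x in S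
   modulo a prime p > k, which is at most the size M of the region unless the
   point is x itself; since there are at most (3 M / p)^m of them for each p
   and m >= 2, their density is O(1/k).
   No scaling property of Lebesgue measure is needed: that vol B_(r+c) / vol B_r
   tends to 1 follows from comparing volumes with lattice point counts at two
   proportional scales. *)

Require Import Defs.
From mathcomp Require Import all_boot all_order all_algebra finmap.
From mathcomp Require Import zify ring lra.
From mathcomp Require Import all_classical all_reals all_analysis.

Import Order.TTheory GRing.Theory Num.Theory.
Import numFieldNormedType.Exports.

Local Open Scope classical_set_scope.
Local Open Scope ring_scope.

(** Lets finite sets of different types be compared through an explicit map between their
    enumerations. *)
Lemma leq_size_inj_in (T U : eqType) (f : T -> U) (s : seq T) (t : seq U) :
  uniq s -> {in s &, injective f} -> {in s, forall x, f x \in t} ->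
  (size s <= size t)%N.
Proof.
move=> us inj sub; rewrite -(size_map f); apply: uniq_leq_size.
  by rewrite map_inj_in_uniq.
by move=> _ /mapP[x xs ->]; exact: sub.
Qed.

(** * Perturbation and scaling of the Euclidean norm *)

Section euclidean_norm.
Variables (R : realType) (m : nat).
Implicit Types (x y : m.-tuple R).

Lemma eucl_norm_ge0 x : 0 <= eucl_norm x.
Proof. exact: sqrtr_ge0. Qed.

Lemma sqr_eucl_norm x : eucl_norm x ^+ 2 = \sum_(i < m) tnth x i ^+ 2.
Proof. by rewrite sqr_sqrtr// sumr_ge0// => i _; exact: sqr_ge0. Qed.

(** With [u] the difference in a coordinate and [v] that coordinate of [y], [u * v] is at most
    [d * eucl_norm y]. Summing the squares [(u + v) ^+ 2] and using [m <= m ^ 2] gives the square of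
    the right-hand side. The factor [m] is cruder than the square root of [m], but spares the
    Cauchy-Schwarz inequality. *)
Lemma eucl_norm_le_add x y (d : R) : 0 <= d ->
  (forall i, `|tnth x i - tnth y i| <= d) ->
  eucl_norm x <= eucl_norm y + m%:R * d.
Proof.
move=> d0 xy; have y0 := eucl_norm_ge0 y.
have e0 : 0 <= eucl_norm y + m%:R * d by rewrite addr_ge0 ?mulr_ge0.
rewrite -(@ler_pXn2r _ 2) ?nnegrE// ?eucl_norm_ge0// sqr_eucl_norm.
apply: (@le_trans _ _
  (\sum_(i < m) (tnth y i ^+ 2 + (2 * d * eucl_norm y + d ^+ 2)))).
  apply: ler_sum => i _.
  have [u -> ud] : exists2 u, tnth x i = u + tnth y i & `|u| <= d.
    by exists (tnth x i - tnth y i); rewrite ?subrK.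
  move: (tnth y i) (le_eucl_norm y i) => v vy.
  have : u * v <= d * eucl_norm y.
    by rewrite (le_trans (ler_norm _))// normrM ler_pM.
  have : u ^+ 2 <= d ^+ 2.
    by rewrite -[u ^+ 2]real_normK ?num_real// ler_pXn2r ?nnegrE.
  nra.
rewrite big_split/= -sqr_eucl_norm sumr_const card_ord -[X in _ + X]mulr_natl.
have : m%:R * d ^+ 2 <= m%:R ^+ 2 * d ^+ 2.
  by rewrite ler_wpM2r ?sqr_ge0// -natrX ler_nat; case: (m) => // n; lia.
nra.
Qed.

Lemma eucl_norm_scale x y (t : R) : 0 <= t ->
  (forall i, tnth x i = t * tnth y i) -> eucl_norm x = t * eucl_norm y.
Proof.
move=> t0 xy; rewrite /eucl_norm -[X in X * _](ger0_norm t0) -sqrtr_sqr.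
rewrite -sqrtrM ?sqr_ge0// mulr_sumr; congr Num.sqrt.
by apply: eq_bigr => i _; rewrite xy exprMn.
Qed.

End euclidean_norm.

(** * Ball volumes compared with lattice point counts *)

Section ball_volume.
Variables (R : realType) (m : nat).

Definition ball_volume (r : R) : R :=
  fine (lebesgue_measure_tuple (eucl_ball m r)).

Lemma ball_volumeE r :
  lebesgue_measure_tuple (eucl_ball m r) = (ball_volume r)%:E.
Proof. by rewrite fineK// lebesgue_measure_eucl_ball_fin_num. Qed.

Lemma ball_volume_ge0 r : 0 <= ball_volume r.
Proof. by rewrite -lee_fin -ball_volumeE. Qed.

(** Half-open, so that for fixed [t > 0] the cubes partition space: [x] lies in the one whose index
    is the floor of [x / t]. *)
Definition cube (t : R) (w : m.-tuple int) : set (m.-tuple R) :=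
  [set x | forall i, `[t * (tnth w i)%:~R, t * (tnth w i + 1)%:~R[%classic
                     (tnth x i)].

Lemma measurable_cube t w : measurable (cube t w).
Proof.
rewrite (_ : cube t w = \bigcap_(i in [set: 'I_m])
    ((fun x : m.-tuple R => tnth x i) @^-1`
      `[t * (tnth w i)%:~R, t * (tnth w i + 1)%:~R[)); last first.
  by apply/seteqP; split => [x xw i _|x xw i]; [exact: xw|exact: (xw i)].
apply: fin_bigcap_measurable => // i _; rewrite -[X in measurable X]setTI.
by apply: measurable_tnth => //; exact: measurable_itv.
Qed.

Lemma lebesgue_measure_cube t w : 0 < t ->
  lebesgue_measure_tuple (cube t w) = (t ^+ m)%:E.
Proof.
move=> t0; rewrite (lebesgue_measure_tuple_box (A := fun i =>
  `[t * (tnth w i)%:~R, t * (tnth w i + 1)%:~R[%classic))//.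
rewrite (eq_bigr (fun=> t%:E)).
  by rewrite prodEFin prodr_const card_ord.
move=> i _; rewrite lebesgue_measure_itv/= lte_fin ltr_pM2l// ltr_int ltrDl/=.
rewrite -EFinB; congr EFin; rewrite intrD; ring.
Qed.

Lemma cubeP t w x : 0 < t ->
  cube t w x <-> forall i, tnth w i = Num.floor (tnth x i / t).
Proof.
move=> t0; split=> xw i.
  have := xw i; rewrite /= in_itv/= => /andP[? ?]; apply/esym/floor_def.
  by rewrite ler_pdivlMr// ltr_pdivrMr// mulrC [_ * t]mulrC; apply/andP.
rewrite /= in_itv/= [t * _]mulrC [t * _]mulrC -ler_pdivlMr// -ltr_pdivrMr//.
by rewrite xw ge_floor floorD1_gt.
Qed.

(** Each coordinate of [x] is within [t] of that of the corner [t * w]. *)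
Lemma cube_norm t w x : 0 < t -> cube t w x ->
  eucl_norm x <= t * eucl_norm (real_of_lattice R w) + m%:R * t /\
  t * eucl_norm (real_of_lattice R w) <= eucl_norm x + m%:R * t.
Proof.
move=> t0 xw.
pose y := [tuple t * tnth (real_of_lattice R w) i | i < m].
have <- : eucl_norm y = t * eucl_norm (real_of_lattice R w).
  by apply: eucl_norm_scale => [|i]; rewrite ?ltW// tnth_mktuple.
have xy i : `|tnth x i - tnth y i| <= t.
  have := xw i; rewrite /= in_itv/= !tnth_mktuple tnth_map intrD mulrDr mulr1.
  by move=> /andP[? ?]; rewrite ler_norml; lra.
split; apply: eucl_norm_le_add; rewrite ?ltW// => i.
by rewrite distrC.
Qed.

Arguments cubeP {t w x}.
Arguments cube_norm {t w x}.

Definition lattice_ball (r : R) : {fset m.-tuple int} :=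
  fset_set ([set: m.-tuple int] `&` real_of_lattice R (m := m) @^-1` eucl_ball m r).

Lemma in_lattice_ball r w :
  (w \in lattice_ball r) = (eucl_norm (real_of_lattice R w) < r).
Proof.
rewrite in_fset_set; last exact: finite_lattice_ball.
by apply/idP/idP; rewrite inE/=; [case|split].
Qed.

Lemma measure_cubes t (L : {fset m.-tuple int}) : 0 < t ->
  lebesgue_measure_tuple (\big[setU/set0]_(w <- L) cube t w) =
  (t ^+ m * #|` L|%:R)%:E.
Proof.
move=> t0; rewrite measure_fbigsetU.
- rewrite (eq_bigr (fun=> (t ^+ m)%:E)); last first.
    by move=> w _; exact: lebesgue_measure_cube.
  by rewrite sumEFin big_const_seq count_predT iter_addr_0 mulr_natr.
- by move=> w _; exact: measurable_cube.
- move=> u w _ _ [x [/(cubeP t0) ux /(cubeP t0) wx]].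
  by apply: eq_from_tnth => i; rewrite ux wx.
Qed.

Lemma measurable_cubes t (L : {fset m.-tuple int}) :
  measurable (\big[setU/set0]_(w <- L) cube t w).
Proof. by apply: bigsetU_measurable => w _; exact: measurable_cube. Qed.

(** The disjoint cubes of side [t] indexed by the lattice ball of radius [r / t] are contained in
    the ball of radius [r + m * t]. *)
Lemma lattice_ball_le_volume t r : 0 < t ->
  t ^+ m * #|` lattice_ball (r / t)|%:R <= ball_volume (r + m%:R * t).
Proof.
move=> t0; rewrite -lee_fin -measure_cubes// -ball_volumeE.
apply: le_measure; rewrite ?inE.
- exact: measurable_cubes.
- exact: measurable_eucl_ball.
move=> x; rewrite -bigcup_fset => -[w /=].
rewrite in_lattice_ball ltr_pdivlMr// mulrC => wr /(cube_norm t0)[xw _].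
by rewrite /eucl_ball /=; lra.
Qed.

(** Conversely, any cube of side [t] that meets the ball of radius [r - m * t] has its index in the
    lattice ball of radius [r / t]. *)
Lemma volume_le_lattice_ball t r : 0 < t ->
  ball_volume (r - m%:R * t) <= t ^+ m * #|` lattice_ball (r / t)|%:R.
Proof.
move=> t0; rewrite -lee_fin -measure_cubes// -ball_volumeE.
apply: le_measure; rewrite ?inE.
- exact: measurable_eucl_ball.
- exact: measurable_cubes.
move=> x xr; rewrite -bigcup_fset.
pose w := [tuple Num.floor (tnth x i / t) | i < m].
have xw : cube t w x by apply/cubeP => // i; rewrite tnth_mktuple.
exists w => //=; rewrite in_lattice_ball ltr_pdivlMr// mulrC.
have [_ ?] := cube_norm t0 xw; move: xr; rewrite /eucl_ball /=; lra.
Qed.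

(* Both sides are compared with the same set of lattice points, seen at the
   scales t and a * t for a small t. *)
Lemma ball_volume_scale_le (a r e : R) : 0 < a -> 0 < e ->
  ball_volume (a * r - e) <= a ^+ m * ball_volume (r + e).
Proof.
move=> a0 e0.
have mono s s' : s <= s' -> ball_volume s <= ball_volume s'.
  move=> ss'; rewrite -lee_fin -!ball_volumeE.
  apply: le_measure; rewrite ?inE; [exact: measurable_eucl_ball..|].
  by move=> x /lt_le_trans; exact.
pose t := e / ((1 + m%:R) * (1 + a)).
have m0 : 0 <= m%:R :> R by [].
have t0 : 0 < t by rewrite divr_gt0// mulr_gt0//; lra.
have te : t * ((1 + m%:R) * (1 + a)) = e by rewrite divfK// gt_eqF// mulr_gt0//; lra.
have at0 : 0 < a * t by rewrite mulr_gt0.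
have mt0 : 0 <= m%:R * t by nra.
apply: (@le_trans _ _ (ball_volume (a * r - m%:R * (a * t)))).
  by apply: mono; nra.
apply: (le_trans (volume_le_lattice_ball (a * t) (a * r) at0)).
rewrite exprMn -mulrA ler_pM2l ?exprn_gt0//.
have -> : a * r / (a * t) = r / t by field; rewrite !gt_eqF.
apply: (le_trans (lattice_ball_le_volume t r t0)).
by apply: mono; nra.
Qed.

(** The cube of side [b = r / (m + 1)] at the origin has points of norm at most [m * b < r]. The
    bound yields positivity and growth of order [r ^ m]; the exact volume is never computed. *)
Lemma ball_volume_ge (r : R) : 0 < r -> (r / m.+1%:R) ^+ m <= ball_volume r.
Proof.
move=> r0; set b := r / m.+1%:R.
have b0 : 0 < b by rewrite divr_gt0.
rewrite -lee_fin -ball_volumeE.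
rewrite -(lebesgue_measure_cube b [tuple 0 | i < m] b0).
apply: le_measure; rewrite ?inE.
- exact: measurable_cube.
- exact: measurable_eucl_ball.
move=> x /(cube_norm b0)[xb _]; apply: (le_lt_trans xb).
have -> : eucl_norm (real_of_lattice R [tuple 0 | i < m]) = 0.
  rewrite /eucl_norm big1 ?sqrtr0// => i _.
  by rewrite tnth_map tnth_mktuple expr0n.
have -> : r = m.+1%:R * b by rewrite mulrC divfK.
by rewrite -natr1; lra.
Qed.

End ball_volume.

(** * Periodic sets and their residue counts *)

Section residues.
Variable m : nat.
Implicit Types (z : m.-tuple int) (P : pred (m.-tuple int)).

Definition periodic_mod (Q : nat) P :=
  forall z z', (forall i, (tnth z i = tnth z' i %[mod Q])%Z) -> P z = P z'.

Definition lift_residue {Q : nat} (t : m.-tuple 'I_Q) : m.-tuple int :=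
  [tuple (tnth t i : nat)%:Z | i < m].

Definition residues (Q : nat) P : {set m.-tuple 'I_Q} :=
  [set t | P (lift_residue t)].

Lemma ltn_modz_abs {Q : nat} (Q0 : (0 < Q)%N) (a : int) :
  (absz (a %% Q)%Z < Q)%N.
Proof. by have := @ltz_mod a Q; have := @modz_ge0 a Q; lia. Qed.

Definition residue {Q : nat} (Q0 : (0 < Q)%N) z : m.-tuple 'I_Q :=
  [tuple Ordinal (ltn_modz_abs Q0 (tnth z i)) | i < m].

Lemma tnth_lift_residue Q (t : m.-tuple 'I_Q) i :
  tnth (lift_residue t) i = (tnth t i : nat)%:Z.
Proof. by rewrite tnth_mktuple. Qed.

Lemma tnth_residue Q (Q0 : (0 < Q)%N) z i :
  (tnth (residue Q0 z) i : nat)%:Z = (tnth z i %% Q)%Z.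
Proof. by rewrite tnth_mktuple/= gez0_abs// modz_ge0//; lia. Qed.

Lemma lift_residueK Q (Q0 : (0 < Q)%N) z i :
  (tnth (lift_residue (residue Q0 z)) i = tnth z i %[mod Q])%Z.
Proof. by rewrite tnth_lift_residue tnth_residue modz_mod. Qed.

Lemma lift_residue_inj Q (t t' : m.-tuple 'I_Q) :
  (forall i, (tnth (lift_residue t) i = tnth (lift_residue t') i %[mod Q])%Z) ->
  t = t'.
Proof.
move=> tt'; apply: eq_from_tnth => i; apply: val_inj => /=.
have := tt' i; rewrite !tnth_lift_residue !modz_nat !modn_small ?ltn_ord//.
by case.
Qed.

Lemma residues_residue Q (Q0 : (0 < Q)%N) P z : periodic_mod Q P ->
  (residue Q0 z \in residues Q P) = P z.
Proof. by move=> perP; rewrite inE; apply: perP => i; exact: lift_residueK. Qed.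

(** Chinese remainder theorem: reduction modulo [Q] and [q] is injective on tuples modulo [Q * q],
    hence bijective by cardinality, and it carries the conjunction to a product set. *)
Lemma card_residues_mul Q q P P' : coprime Q q -> (0 < Q)%N -> (0 < q)%N ->
  periodic_mod Q P -> periodic_mod q P' ->
  #|residues (Q * q) [pred z | P z && P' z]| =
  (#|residues Q P| * #|residues q P'|)%N.
Proof.
move=> cQq Q0 q0 perP perP'.
pose f (t : m.-tuple 'I_(Q * q)) :=
  (residue Q0 (lift_residue t), residue q0 (lift_residue t)).
have finj : injective f.
  move=> t t' ftt'; apply: lift_residue_inj => i.
  rewrite PoszM; apply/eqP; rewrite zchinese_remainder; last first.
    by rewrite coprimezE.
  have tQ : residue Q0 (lift_residue t) = residue Q0 (lift_residue t').
    exact: (congr1 fst ftt').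
  have tq : residue q0 (lift_residue t) = residue q0 (lift_residue t').
    exact: (congr1 snd ftt').
  by rewrite -!(tnth_residue _ Q0) -!(tnth_residue _ q0) tQ tq !eqxx.
have fbij : bijective f.
  apply: inj_card_bij => //.
  by rewrite card_prod !card_tuple !card_ord expnMn.
rewrite -cardsX -(on_card_preimset (onW_bij _ fbij)).
apply: eq_card => t; rewrite !inE/=.
congr andb; [apply: perP|apply: perP'] => i; exact/esym/lift_residueK.
Qed.

Lemma proj_modP (p : nat) z z' : prime p ->
  proj_mod p z = proj_mod p z' <->
  forall i, (p %| tnth z i - tnth z' i)%Z.
Proof.
move=> pp.
have cp : p \in [pchar 'Z_p].
  by rewrite inE pp; apply/eqP/pchar_Zp/prime_gt1.
have eqp (a b : int) : (p %| a - b)%Z = (a%:~R == b%:~R :> 'Z_p).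
  by rewrite (dvdz_pcharf cp) intrB subr_eq0.
split=> [zz' i|zz'].
  rewrite eqp; apply/eqP.
  by have := congr1 (fun t => tnth t i) zz'; rewrite !tnth_map.
by apply: eq_from_tnth => i; rewrite !tnth_map; apply/eqP; rewrite -eqp.
Qed.

(** The representatives in ['I_p] biject with the tuples over ['Z_p], so the count is that of the
    complement of [F]. *)
Lemma card_residues_prime (p : nat) (F : {fset m.-tuple 'Z_p}) : prime p ->
  #|residues p [pred z | proj_mod p z \notin F]| = (p ^ m - #|` F|)%N.
Proof.
move=> pp.
pose f (t : m.-tuple 'I_p) := proj_mod p (lift_residue t).
have finj : injective f.
  move=> t t' /(proj_modP _ _ _ pp) tt'; apply: lift_residue_inj => i.
  by apply/eqP; rewrite eqz_mod_dvd.
have cZ : #|{: m.-tuple 'Z_p}| = (p ^ m)%N.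
  by rewrite card_tuple card_ord Zp_cast ?prime_gt1.
have fbij : bijective f.
  by apply: inj_card_bij => //; rewrite cZ card_tuple card_ord.
pose G : {set m.-tuple 'Z_p} := [set t in enum_fset F].
have -> : #|` F| = #|G| by rewrite cardsE; apply/esym/card_uniqP/fset_uniq.
have -> : (p ^ m - #|G| = #|~: G|)%N by rewrite [RHS]cardsCs finset.setCK cZ.
rewrite -(on_card_preimset (onW_bij _ fbij)).
by apply: eq_card => t; rewrite !inE.
Qed.

End residues.

(** * The sieve by small primes and its Euler product *)

Section sieve.
Variables (m : nat) (S : {fset m.-tuple int}).

Definition avoids_mod (p : nat) : pred (m.-tuple int) :=
  [pred z | proj_mod p z \notin [fset proj_mod p x | x in S]%fset].

(** The primes are strictly below [n], the same range as in [primorial] and [euler_product]. *)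
Definition sieve (n : nat) : pred (m.-tuple int) :=
  [pred z | all [pred p | prime p ==> avoids_mod p z] (iota 0 n)].

Definition primorial (n : nat) : nat := \prod_(p < n | prime p) p.

Lemma primorialS n :
  primorial n.+1 = (primorial n * (if prime n then n else 1))%N.
Proof. by rewrite /primorial big_mkcond big_ord_recr/= -big_mkcond. Qed.

Lemma primorial_gt0 n : (0 < primorial n)%N.
Proof. by apply: prodn_cond_gt0 => p /prime_gt0. Qed.

Lemma coprime_primorial n : prime n -> coprime (primorial n) n.
Proof.
move=> pn; rewrite coprime_sym prime_coprime// Euclid_dvd_prod//.
rewrite big_orE; apply/existsP => -[p /andP[/prime_gt0 p0 /(dvdn_leq p0)]].
by rewrite leqNgt ltn_ord.
Qed.

Lemma periodic_avoids_mod p : prime p -> periodic_mod m p (avoids_mod p).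
Proof.
move=> pp z z' zz'; rewrite /avoids_mod/= (_ : proj_mod p z = proj_mod p z')//.
by apply/proj_modP => // i; rewrite -eqz_mod_dvd; apply/eqP.
Qed.

Lemma sieveS n z : sieve n.+1 z = sieve n z && (prime n ==> avoids_mod n z).
Proof. by rewrite /sieve -addn1 iotaD/= all_cat/= andbT. Qed.

Lemma periodic_dvd (Q q : nat) P : (q %| Q)%N ->
  periodic_mod m q P -> periodic_mod m Q P.
Proof.
move=> qQ perP z z' zz'; apply: perP => i; apply/eqP; rewrite eqz_mod_dvd.
apply: (@dvdz_trans Q) => //; by rewrite -eqz_mod_dvd; apply/eqP.
Qed.

Lemma periodic_sieve n : periodic_mod m (primorial n) (sieve n).
Proof.
elim: n => [//|n IHn] z z' zz'; rewrite !sieveS; congr andb.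
  by apply: (periodic_dvd _ _ _ _ IHn) zz'; rewrite primorialS dvdn_mulr.
case: ifPn (primorialS n) => [pn e|//]; rewrite /=.
by apply: (periodic_dvd _ _ _ _ (periodic_avoids_mod n pn)) zz'; rewrite e dvdn_mull.
Qed.

(** By induction on [n]: a prime [n] is coprime to [primorial n], so it multiplies the count by its
    number of avoided residues, [n ^ m - num_residues S n]. *)
Lemma card_residues_sieve (R : realType) n :
  #|residues m (primorial n) (sieve n)|%:R =
  (primorial n)%:R ^+ m * euler_product R S n.
Proof.
elim: n => [|n IHn].
  rewrite /euler_product /primorial !big_ord0 expr1n mulr1.
  rewrite (_ : residues _ _ _ = [set: _]%SET); last by apply/setP => t; rewrite !inE.
  by rewrite cardsT card_tuple card_ord exp1n.
have -> : euler_product R S n.+1 = euler_product R S n *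
    (if prime n then 1 - (num_residues S n)%:R / n%:R ^+ m else 1).
  by rewrite /euler_product big_mkcond big_ord_recr/= -big_mkcond.
case: ifPn (primorialS n) => [pn ->|pn]; last first.
  rewrite muln1 mulr1 => ->; rewrite -IHn; congr _%:R; apply: eq_card => t.
  by rewrite !inE -/(sieve n.+1 _) sieveS (negbTE pn) andbT.
have -> : residues m (primorial n * n) (sieve n.+1) =
    residues m (primorial n * n) [pred z | sieve n z && avoids_mod n z].
  by apply/setP => t; rewrite !inE -/(sieve n.+1 _) sieveS pn.
rewrite card_residues_mul ?coprime_primorial ?primorial_gt0 ?prime_gt0//; first last.
- exact: periodic_avoids_mod.
- exact: periodic_sieve.
rewrite natrM IHn card_residues_prime// -/(num_residues S n) natrB; last first.
  exact: num_residues_le.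
rewrite natrM exprMn natrX.
have : n%:R != 0 :> R by rewrite pnatr_eq0 -lt0n prime_gt0.
by move=> n0; field; rewrite expf_neq0.
Qed.

End sieve.

(** * Counting a periodic set in a ball *)

Lemma mem_count_in_ball (R : realType) (m : nat) (A : set (m.-tuple int)) (r : R) z :
  z \in fset_set (A `&` real_of_lattice R (m := m) @^-1` eucl_ball m r) <->
  A z /\ eucl_norm (real_of_lattice R z) < r.
Proof.
by rewrite in_fset_set ?inE//; exact: finite_lattice_ball.
Qed.

Section count_periodic.
Variables (R : realType) (m : nat) (Q : nat) (P : pred (m.-tuple int)).
Hypotheses (Q0 : (0 < Q)%N) (perP : periodic_mod m Q P).

Let Qr0 : 0 < Q%:R :> R. Proof. by rewrite ltr0n. Qed.

(** The hypothesis says that [z], seen as a real point, lies in the cube of side [Q] with index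
    [w]. *)
Lemma eucl_norm_residue_quotient (z w : m.-tuple int) :
  (forall i, 0 <= tnth z i - Q%:Z * tnth w i < Q%:Z) ->
  eucl_norm (real_of_lattice R z) <=
    Q%:R * eucl_norm (real_of_lattice R w) + m%:R * Q%:R /\
  Q%:R * eucl_norm (real_of_lattice R w) <=
    eucl_norm (real_of_lattice R z) + m%:R * Q%:R.
Proof.
move=> zw; apply: cube_norm => // i; have := zw i.
rewrite /= in_itv/= tnth_map => /andP[zw0 zwQ].
rewrite -[Q%:R]/(Q%:Z%:~R) -!intrM ler_int ltr_int mulrDr mulr1.
by rewrite -ltrBlDl zwQ -subr_ge0 zw0.
Qed.

(** Euclidean division by [Q] sends [z] injectively to its residue and its quotient, the latter of
    norm below [(r + m * Q) / Q]. *)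
Lemma count_periodic_le (r : R) :
  (count_in_ball [set z | P z] r <=
   #|residues m Q P| * #|` lattice_ball R m ((r + m%:R * Q%:R) / Q%:R)|)%N.
Proof.
pose quot (z : m.-tuple int) := [tuple (tnth z i %/ Q)%Z | i < m].
rewrite cardE -(size_allpairs pair).
apply: (@leq_size_inj_in _ _ (fun z => (residue m Q0 z, quot z))).
- exact: fset_uniq.
- move=> z z' _ _ e; apply: eq_from_tnth => i.
  have er : residue m Q0 z = residue m Q0 z' := congr1 fst e.
  have eq : quot z = quot z' := congr1 snd e.
  rewrite (divz_eq (tnth z i) Q) (divz_eq (tnth z' i) Q).
  rewrite -!(tnth_residue _ _ Q0) er.
  by have := congr1 (fun t => tnth t i) eq; rewrite !tnth_mktuple => ->.
- move=> z /mem_count_in_ball[/= Pz zr]; apply/allpairsP.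
  exists (residue m Q0 z, quot z); split => //=.
    by rewrite mem_enum residues_residue.
  rewrite in_lattice_ball ltr_pdivlMr// mulrC.
  have [|_] := eucl_norm_residue_quotient z (quot z); last by lra.
  move=> i; rewrite tnth_mktuple mulrC {1 3}(divz_eq (tnth z i) Q).
  by rewrite addrAC subrr add0r modz_ge0 ?ltz_pmod//; lia.
Qed.

(** The reverse map, from a residue [t] and a quotient [w] to [t + Q * w], is injective too. *)
Lemma count_periodic_ge (r : R) :
  (#|residues m Q P| * #|` lattice_ball R m ((r - m%:R * Q%:R) / Q%:R)| <=
   count_in_ball [set z | P z] r)%N.
Proof.
pose point (u : m.-tuple 'I_Q * m.-tuple int) :=
  [tuple (tnth u.1 i : nat)%:Z + Q%:Z * tnth u.2 i | i < m].
have point_mod u i : (tnth (point u) i = tnth (lift_residue m u.1) i %[mod Q])%Z.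
  by rewrite tnth_mktuple addrC mulrC modzMDl tnth_lift_residue.
rewrite cardE -(size_allpairs pair).
apply: (@leq_size_inj_in _ _ point).
- apply: allpairs_uniq => [||[? ?] [? ?] _ _ //]; first exact: enum_uniq.
  exact: fset_uniq.
- move=> u u' _ _ e.
  have e1 : u.1 = u'.1.
    by apply: lift_residue_inj => i; rewrite -!point_mod e.
  case: u u' e1 e => [t w] [t' w'] /= <- e; congr pair.
  apply: eq_from_tnth => i.
  have := congr1 (fun t => tnth t i) e; rewrite !tnth_mktuple/= => /addrI.
  by apply: mulfI; lia.
- move=> _ /allpairsP[[t w] /= [tP wr ->]]; apply/mem_count_in_ball; split.
    move: tP; rewrite mem_enum inE /= => tP.
    by rewrite (perP _ (lift_residue m t))// => i; exact: (point_mod (t, w)).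
  move: wr; rewrite in_lattice_ball ltr_pdivlMr// mulrC => wr.
  have [|+ _] := eucl_norm_residue_quotient (point (t, w)) w; last by lra.
  move=> i; rewrite tnth_mktuple/= addrK ltz_nat ltn_ord.
  by rewrite andbT.
Qed.

(** One shift by [m * Q] comes from passing to quotients, the other from replacing the count of
    quotients by a volume. *)
Lemma count_periodic_volume (r : R) :
  #|residues m Q P|%:R * ball_volume R m (r - 2 * m%:R * Q%:R) <=
    Q%:R ^+ m * (count_in_ball [set z | P z] r)%:R <=
  #|residues m Q P|%:R * ball_volume R m (r + 2 * m%:R * Q%:R).
Proof.
apply/andP; split.
  apply: (@le_trans _ _ (Q%:R ^+ m *
    (#|residues m Q P| *
     #|` lattice_ball R m ((r - m%:R * Q%:R) / Q%:R)|)%:R)).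
    rewrite natrM mulrCA ler_wpM2l//.
    have -> : r - 2 * m%:R * Q%:R = (r - m%:R * Q%:R) - m%:R * Q%:R by ring.
    exact: volume_le_lattice_ball.
  by rewrite ler_wpM2l ?exprn_ge0// ler_nat count_periodic_ge.
apply: (@le_trans _ _ (Q%:R ^+ m *
  (#|residues m Q P| *
   #|` lattice_ball R m ((r + m%:R * Q%:R) / Q%:R)|)%:R)).
  by rewrite ler_wpM2l ?exprn_ge0// ler_nat count_periodic_le.
rewrite natrM mulrCA ler_wpM2l//.
have -> : r + 2 * m%:R * Q%:R = (r + m%:R * Q%:R) + m%:R * Q%:R by ring.
exact: lattice_ball_le_volume.
Qed.

End count_periodic.

(** * Visibility as a condition at every prime, and the points lost by sieving *)

Section visibility.
Variables (m : nat) (S : {fset m.-tuple int}).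
Implicit Types (x z : m.-tuple int).

Lemma dvdz_big_gcdz (I : finType) (d : int) (F : I -> int) :
  (d %| \big[gcdz/0]_i F i)%Z = [forall i, (d %| F i)%Z].
Proof.
apply/idP/forallP => [dF i|dF]; last first.
  by elim/big_ind: _ => [|a b da db|i _]; rewrite ?dvdz0 ?dvdz_gcd ?da ?dF.
have : i \in index_enum I by rewrite mem_index_enum.
elim: (index_enum I) dF => [//|j s IHs]; rewrite big_cons dvdz_gcd inE.
by move=> /andP[dj ds] /predU1P[->//|]; exact: IHs.
Qed.

Lemma visibleP z : visible S z <-> forall p, prime p -> avoids_mod m S p z.
Proof.
split=> [vz p pp|az x xS].
  apply/negP => /imfsetP[x /= xS /(proj_modP _ _ _ _ pp) pzx].
  have : (p %| \big[gcdz/0]_(i < m) (tnth z i - tnth x i))%Z.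
    by rewrite dvdz_big_gcdz; apply/forallP.
  by rewrite (vz _ xS) dvdz1 => /eqP p1; move: pp; rewrite -[p]/(absz p) p1.
have : 0 <= \big[gcdz/0]_(i < m) (tnth z i - tnth x i).
  by elim/big_rec: _.
have ndvd (p : nat) : prime p ->
    ~~ (p %| \big[gcdz/0]_(i < m) (tnth z i - tnth x i))%Z.
  move=> pp; apply/negP; rewrite dvdz_big_gcdz => /forallP pzx.
  by have /negP := az _ pp; apply; apply/imfsetP; exists x => //; exact/proj_modP.
(* A nonnegative gcd other than 1 is either 0, which the prime 2 divides, or at least 2, which has a
   least prime divisor. *)
case: (\big[gcdz/0]_(i < m) _) ndvd => // -[|[//|g]] ndvd _.
  by have := ndvd 2 isT; rewrite dvdz0.
have gp : prime (pdiv g.+2) by rewrite pdiv_prime.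
by have := ndvd _ gp; rewrite dvdzE/= pdiv_dvd.
Qed.

Lemma visible_sieve n z : visible S z -> sieve m S n z.
Proof.
by move=> /visibleP az; apply/allP => p _ /=; apply/implyP; exact: az.
Qed.

Definition coordinate_bound : nat :=
  (\max_(x <- S) \max_(i < m) absz (tnth x i))%N.

Lemma coordinate_boundP x i : x \in S -> (absz (tnth x i) <= coordinate_bound)%N.
Proof.
move=> xS; rewrite /coordinate_bound (big_rem x)//= leq_max.
by rewrite (leq_bigmax (F := fun j => absz (tnth x j)) i).
Qed.

(* The points [x + p (u - M %/ p)] with [0 <= u_i <= 2 (M %/ p)] are those at
   distance at most [M] from [x] that are congruent to [x] modulo [p]. *)
Definition congruent_points (M p : nat) (x : m.-tuple int) : seq (m.-tuple int) :=
  [seq [tuple tnth x i + p%:Z * ((tnth u i : nat)%:Z - (M %/ p)%:Z) | i < m]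
  | u : m.-tuple 'I_((M %/ p).*2.+1)].

Lemma size_congruent_points M p x :
  size (congruent_points M p x) = ((M %/ p).*2.+1 ^ m)%N.
Proof. by rewrite size_map -cardE card_tuple card_ord. Qed.

Lemma mem_congruent_points M p x z : (0 < p)%N ->
  (forall i, (p %| tnth z i - tnth x i)%Z) ->
  (forall i, (absz (tnth z i - tnth x i) <= M)%N) ->
  z \in congruent_points M p x.
Proof.
move=> p0 pzx zxM.
pose u := [tuple inord (absz (divz (tnth z i - tnth x i) p + (M %/ p)%N%:Z))
          : 'I_(M %/ p).*2.+1 | i < m].
apply/mapP; exists u; first by rewrite mem_enum.
apply: eq_from_tnth => i; rewrite !tnth_mktuple.
have /dvdzP[q zxq] := pzx i.
have qM : (absz q <= M %/ p)%N.
  by rewrite leq_divRL//; have := zxM i; rewrite zxq abszM.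
rewrite zxq mulzK; last by lia.
rewrite inordK; last by lia.
rewrite gez0_abs; last by lia.
by rewrite addrK mulrC -zxq addrC subrK.
Qed.

(** Some prime [p] divides every [z_i - x_i] for some [x] in [S]. It is at least [n] because [z]
    survives the sieve, and if [z] differs from [x], a nonzero coordinate difference forces
    [p <= M]. *)
Lemma sieve_not_visible n M z : sieve m S n z -> ~ visible S z ->
  (forall x i, x \in S -> (absz (tnth z i - tnth x i) <= M)%N) ->
  exists2 x, x \in S &
    z = x \/ exists2 p, p \in index_iota n M.+1 & z \in congruent_points M p x.
Proof.
move=> sz nvz zM.
have [p [pp]] : exists p, prime p /\ ~~ avoids_mod m S p z.
  apply: contra_notP nvz => nex; apply/visibleP => p pp.
  by case: (boolP (avoids_mod m S p z)) => // naz; case: nex; exists p.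
rewrite negbK => azp; have /imfsetP[x /= xS /(proj_modP _ _ _ _ pp) pzx] := azp.
exists x => //; have [|zx] := eqVneq z x; [by left|right].
exists p; last by apply: mem_congruent_points => // [|i]; rewrite ?prime_gt0 ?zM.
rewrite mem_index_iota ltnS; apply/andP; split.
  rewrite leqNgt; apply/negP => pn; have /= := allP sz p.
  by rewrite mem_iota add0n pn => /(_ isT)/implyP/(_ pp)/negP[].
have [i zxi] : exists i, tnth z i != tnth x i.
  apply/existsP; apply: contraNT zx; rewrite negb_exists => /forallP zx.
  by apply/eqP/eq_from_tnth => i; apply/eqP; rewrite -[_ == _]negbK zx.
apply: leq_trans (zM x i xS); apply: dvdn_leq; last by have := pzx i; rewrite dvdzE.
by rewrite absz_gt0 subr_eq0.
Qed.

(** A union bound over [x] in [S]. The successor of the sum counts [x] itself, and the sum runs over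
    all integers from [n] to [M], an overcount of the primes. *)
Lemma count_sieve_le (R : realType) n M (r : R) :
  (Num.truncn r + coordinate_bound < M)%N ->
  (count_in_ball [set z | sieve m S n z] r <= count_in_ball (visible S) r +
    #|` S| * (\sum_(n <= p < M.+1) (M %/ p).*2.+1 ^ m).+1)%N.
Proof.
move=> rM.
pose bad := flatten [seq x :: flatten [seq congruent_points M p x
  | p <- index_iota n M.+1] | x <- S].
have -> : (#|` S| * (\sum_(n <= p < M.+1) (M %/ p).*2.+1 ^ m).+1 = size bad)%N.
  rewrite size_flatten /shape -map_comp sumnE big_map.
  rewrite [RHS](eq_bigr (fun=> (\sum_(n <= p < M.+1) (M %/ p).*2.+1 ^ m).+1)).
    by rewrite big_const_seq count_predT iter_addn_0 mulnC.
  move=> x _ /=; rewrite size_flatten /shape -map_comp sumnE big_map; congr _.+1.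
  by apply: eq_bigr => p _; rewrite /= size_congruent_points.
rewrite -size_cat; apply: uniq_leq_size; first exact: fset_uniq.
move=> z /mem_count_in_ball[/= sz zr]; rewrite mem_cat.
have [vz|nvz] := pselect (visible S z).
  by apply/orP; left; apply/mem_count_in_ball.
apply/orP; right.
have zM x i : x \in S -> (absz (tnth z i - tnth x i) <= M)%N.
  move=> xS; have := coordinate_boundP x i xS.
  have : (absz (tnth z i) < (Num.truncn r).+1)%N.
    rewrite -ltz_nat -(ltr_int R) abszE intr_norm.
    apply: le_lt_trans (truncnS_gt r); apply: le_trans (ltW zr).
    by have := le_eucl_norm (real_of_lattice R z) i; rewrite tnth_map.
  by lia.
have [x xS zx] := sieve_not_visible n M z sz nvz zM.
apply/flatten_mapP; exists x => //; rewrite inE.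
case: zx => [->|[p pM zp]]; first by rewrite eqxx.
by apply/orP; right; apply/flatten_mapP; exists p.
Qed.

End visibility.

(** * Analytic estimates *)

Section estimates.
Variable R : realType.

(** Telescoping: [1 / p ^ 2] is at most [1 / (p - 1) - 1 / p]. *)
Lemma sum_inv_sqr_le (k n : nat) : (0 < k <= n)%N ->
  \sum_(k.+1 <= p < n.+1) (p%:R ^+ 2)^-1 <= k%:R^-1 - n%:R^-1 :> R.
Proof.
move=> /andP[k0]; elim: n => [|n IHn]; first by lia.
rewrite leq_eqVlt => /predU1P[<-|kn]; first by rewrite big_geq// subrr.
rewrite big_nat_recr//=; apply: le_trans (lerD (IHn kn) (lexx _)) _.
have n0 : 0 < n%:R :> R by rewrite ltr0n; lia.
have telescope (a b c d : R) : d <= b - c -> a - b + d <= a - c by lra.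
apply: telescope.
rewrite -natr1; move: (n%:R : R) n0 => x x0; rewrite -subr_ge0.
have -> : x^-1 - (x + 1)^-1 - ((x + 1) ^+ 2)^-1 = (x * (x + 1) ^+ 2)^-1.
  by field; rewrite !gt_eqF//; lra.
by rewrite invr_ge0 mulr_ge0 ?exprn_ge0//; lra.
Qed.

(** For [p <= M] the quotient [M %/ p] is at least 1, whence [2 * (M %/ p) + 1 <= 3 * M / p]. As
    [m >= 2], the powers [p ^ m] may be replaced by [p ^ 2] in the denominators, and the inverse
    squares beyond [k] sum to at most [1 / k]. *)
Lemma sum_congruent_le (m k M : nat) : (2 <= m)%N -> (0 < k)%N ->
  (\sum_(k.+1 <= p < M.+1) (M %/ p).*2.+1 ^ m)%:R <=
  (3 * M%:R) ^+ m / k%:R :> R.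
Proof.
move=> m2 k0; have [Mk|kM] := ltnP M k.
  by rewrite big_geq ?divr_ge0 ?exprn_ge0 ?mulr_ge0//; lia.
apply: (@le_trans _ _ ((3 * M%:R) ^+ m *
    \sum_(k.+1 <= p < M.+1) (p%:R ^+ 2)^-1)).
  rewrite natr_sum mulr_sumr !big_nat; apply: ler_sum => p /andP[kp pM].
  have p0 : 0 < p%:R :> R by rewrite ltr0n; lia.
  apply: (@le_trans _ _ ((3 * M%:R / p%:R) ^+ m)).
    rewrite natrX lerXn2r ?nnegrE ?divr_ge0 ?mulr_ge0// ler_pdivlMr//.
    rewrite -!natrM ler_nat.
    have : (0 < M %/ p)%N by rewrite divn_gt0; lia.
    have := leq_divM M p; nia.
  rewrite expr_div_n ler_wpM2l ?exprn_ge0 ?mulr_ge0// lef_pV2 ?posrE ?exprn_gt0//.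
  by apply: ler_weXn2l => //; rewrite ler1n; lia.
rewrite ler_wpM2l ?exprn_ge0 ?mulr_ge0//.
apply: (le_trans (sum_inv_sqr_le k M _)); first by rewrite k0.
by rewrite gerBl invr_ge0.
Qed.

Lemma cvg_ratio_pinfty (a b : R) : (r + a) / (r + b) @[r --> +oo] --> (1 : R).
Proof.
have inv0 : (r + b)^-1 @[r --> +oo] --> (0 : R).
  apply/gtr0_cvgV0; last exact: cvg_addrr.
  near=> r; rewrite -ltrBlDr sub0r; near: r; apply: nbhs_pinfty_gt.
  exact: num_real.
have : 1 + (a - b) * (r + b)^-1 @[r --> +oo] --> (1 + (a - b) * 0 : R).
  by apply: cvgD; [exact: cvg_cst|apply: cvgMr; exact: inv0].
rewrite mulr0 addr0; apply: cvg_trans; apply: near_eq_cvg; near=> r.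
have rb : 0 < r + b.
  by rewrite -ltrBlDr sub0r; near: r; apply: nbhs_pinfty_gt; rewrite num_real.
by field; rewrite gt_eqF.
Unshelve. all: by end_near. Qed.

End estimates.

(** * Densities of the sieved and of the visible points *)

Section density.
Variables (R : realType) (m : nat) (S : {fset m.-tuple int}).
Implicit Types C r : R.

Lemma ball_volume_gt0 r : 0 < r -> 0 < ball_volume R m r.
Proof.
move=> r0; apply: lt_le_trans (ball_volume_ge R m r r0).
by rewrite exprn_gt0 ?divr_gt0.
Qed.

(** Dilating the radius [r - 1] to [r + C + 1], with slack [e = 1] in [ball_volume_scale_le],
    compares exactly the radii [r] and [r + C]. *)
Lemma ball_volume_addr_le C r : 0 <= C -> C + 1 < r ->
  ball_volume R m (r + C) <= ((r + (C + 1)) / (r + -1)) ^+ m * ball_volume R m r.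
Proof.
move=> C0 Cr; have r1 : 0 < r + -1 by lra.
have a0 : 0 < (r + (C + 1)) / (r + -1) by rewrite divr_gt0//; lra.
have := ball_volume_scale_le R m _ (r + -1) 1 a0 ltr01.
by rewrite divfK ?gt_eqF// subrK addrA addrK.
Qed.

(** Likewise with the dilation from [r - C - 1] to [r + 1], the factor being moved to the other
    side. *)
Lemma ball_volume_subr_ge C r : 0 <= C -> C + 1 < r ->
  ((r + - (C + 1)) / (r + 1)) ^+ m * ball_volume R m r <= ball_volume R m (r - C).
Proof.
move=> C0 Cr; have rC : 0 < r + - (C + 1) by lra.
have r1 : 0 < r + 1 by lra.
have a0 : 0 < (r + 1) / (r + - (C + 1)) by rewrite divr_gt0.
have := ball_volume_scale_le R m _ (r + - (C + 1)) 1 a0 ltr01.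
rewrite divfK ?gt_eqF// addrK opprD addrA subrK -ler_pdivrMl; last first.
  by rewrite exprn_gt0// divr_gt0//; lra.
by rewrite -exprVn invf_div.
Qed.

(** [count_periodic_volume] with period [q] squeezes the count between [a] times the volumes of
    radii [r - C] and [r + C], once [q ^ m] is cancelled. Their ratios to the volume of radius [r]
    are controlled by quantities tending to 1. *)
Lemma count_sieve_density (n : nat) (e : R) : 0 < e ->
  \forall r \near +oo,
    euler_product R S n - e <=
      (count_in_ball [set z | sieve m S n z] r)%:R / ball_volume R m r <=
    euler_product R S n + e.
Proof.
move=> e0; set a := euler_product R S n.
set q := primorial n; pose C : R := 2 * m%:R * q%:R.
have q0 : 0 < q%:R ^+ m :> R by rewrite exprn_gt0// ltr0n primorial_gt0.
have C0 : 0 <= C by rewrite !mulr_ge0.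
have a0 : 0 <= a.
  have : 0 <= q%:R ^+ m * a by rewrite -card_residues_sieve.
  by rewrite pmulr_rge0.
have ratio (b c : R) :
    a * ((r + b) / (r + c)) ^+ m @[r --> +oo] --> a.
  rewrite -[X in _ --> X]mulr1 -[X in a * X](expr1n _ m); apply: cvgMr.
  exact: (continuous_cvg _ (@exprn_continuous R m 1) (cvg_ratio_pinfty R b c)).
have upper := cvgr_le _ (ratio (C + 1) (-1)) (a + e) (ltac:(lra)).
have lower := cvgr_ge _ (ratio (- (C + 1)) 1) (a - e) (ltac:(lra)).
near=> r.
have rC : C + 1 < r by near: r; apply: nbhs_pinfty_gt; exact: num_real.
have v0 : 0 < ball_volume R m r by apply: ball_volume_gt0; lra.
have := count_periodic_volume R m q _ (primorial_gt0 n) (periodic_sieve m S n) r.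
rewrite card_residues_sieve -/q -/a -/C -!mulrA !ler_pM2l// => /andP[lo up].
rewrite ler_pdivlMr// ler_pdivrMr//; apply/andP; split.
  apply: le_trans lo; apply: (@le_trans _ _
    (a * (((r + - (C + 1)) / (r + 1)) ^+ m * ball_volume R m r))).
    by rewrite mulrA ler_pM2r//; near: r.
  by rewrite ler_wpM2l// ball_volume_subr_ge.
apply: (le_trans up); apply: (@le_trans _ _
    (a * (((r + (C + 1)) / (r + -1)) ^+ m * ball_volume R m r))).
  by rewrite ler_wpM2l// ball_volume_addr_le.
by rewrite mulrA ler_pM2r//; near: r.
Unshelve. all: by end_near. Qed.

Lemma count_sieve_sub_visible (k : nat) : (2 <= m)%N -> (0 < k)%N ->
  \forall r \near +oo,
    (count_in_ball [set z | sieve m S k.+1 z] (r : R))%:R / ball_volume R m r -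
    (#|` S|%:R * (1 + (6 * m.+1%:R) ^+ m)) / k%:R <=
    (count_in_ball (visible S) r)%:R / ball_volume R m r.
Proof.
move=> m2 k0; set B := coordinate_bound m S.
have k0' : 0 < k%:R :> R by rewrite ltr0n.
have m0' : 0 < m.+1%:R :> R by rewrite ltr0n.
near=> r.
have rB : (B.+1)%:R < r by near: r; apply: nbhs_pinfty_gt; exact: num_real.
have rk : m.+1%:R * k%:R < r by near: r; apply: nbhs_pinfty_gt; exact: num_real.
have r0 : 0 < r by apply: lt_trans rB; rewrite ltr0n.
have v0 := ball_volume_gt0 r r0.
pose M := (Num.truncn r + B).+1.
(* [M] is the least value allowed by [count_sieve_le]; [B + 1 < r] makes it at most [2 * r]. *)
have Mr : M%:R <= 2 * r.
  have : (Num.truncn r)%:R <= r by rewrite truncn_le ltW.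
  by rewrite /M -addnS natrD; lra.
have := count_sieve_le m S R k.+1 M r (leqnn _).
rewrite -(ler_nat R) natrD natrM -natr1 => count_le.
rewrite lerBlDr ler_pdivrMr// mulrDl divfK ?gt_eqF//.
apply: (le_trans count_le); rewrite lerD2l -!mulrA ler_wpM2l//.
(* The points of [S] themselves are absorbed: the volume is at least [r / (m + 1)], hence at least
   [k], for [r] this large. *)
have s1 : (1 : R) <= k%:R^-1 * ball_volume R m r.
  rewrite mulrC ler_pdivlMr// mul1r; apply: le_trans (ball_volume_ge R m r r0).
  have kr : k%:R <= r / m.+1%:R by rewrite ler_pdivlMr// mulrC ltW.
  apply: (le_trans kr); apply: ler_eXnr; first by lia.
  by apply: le_trans kr; rewrite ler1n.
(* Here [3 * M <= 6 * r], and [r ^ m] is at most [(m + 1) ^ m] times the volume. *)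
have s2 : (3 * M%:R) ^+ m / k%:R <=
    (6 * m.+1%:R) ^+ m * (k%:R^-1 * ball_volume R m r).
  rewrite mulrCA mulrC ler_pM2l ?invr_gt0//.
  apply: (@le_trans _ _ ((6 * m.+1%:R) ^+ m * (r / m.+1%:R) ^+ m)); last first.
    by rewrite ler_wpM2l ?ball_volume_ge// exprn_ge0// mulr_ge0// ltW.
  rewrite -exprMn lerXn2r ?nnegrE ?mulr_ge0 ?divr_ge0 ?(ltW r0)//.
  have -> : 6 * m.+1%:R * (r / m.+1%:R) = 6 * r by field; rewrite gt_eqF.
  by lra.
rewrite mulrDl mul1r addrC lerD//.
exact: le_trans (sum_congruent_le R m k M m2 k0) s2.
Unshelve. all: by end_near. Qed.

End density.

(** * Passage to the limit in the sieving bound *)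

Theorem proposition1p1 (R : realType) (m : nat) (S : {fset m.-tuple int}) :
  (2 <= m)%N ->
  (count_in_ball (visible S) (r : R))%:R /
    fine (lebesgue_measure_tuple (eucl_ball m r))
    @[r --> +oo%R] --> limn (euler_product R S).
Proof.
move=> m2; apply/cvgrPdist_le => e e0.
have e3 : 0 < e / 3 by lra.
set K : R := #|` S|%:R * (1 + (6 * m.+1%:R) ^+ m).
have K0 : 0 <= K by rewrite mulr_ge0// addr_ge0// exprn_ge0// mulr_ge0.
have /cvgrPdist_le/(_ _ e3)[N _ limE] : euler_product R S n @[n --> \oo] -->
  limn (euler_product R S) by exact: is_cvg_euler_product.
(* Large enough both for the partial product to be within [e / 3] of its limit and for the loss
   [K / k] to be at most [e / 3]. The last third goes to the density of the sieved set, taken at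
   [k + 1] so as to include the primes up to [k]. *)
pose k := maxn N (Num.truncn (K / (e / 3))).+1.
have Nk : (N <= k)%N by rewrite leq_maxl.
have k0 : (0 < k)%N by rewrite leq_max orbT.
have Kk : K / k%:R <= e / 3.
  rewrite ler_pdivrMr ?ltr0n// mulrC -ler_pdivrMr//.
  by apply: le_trans (ltW (truncnS_gt _)) _; rewrite ler_nat leq_maxr.
have := limE k.+1 (leqW Nk); rewrite /= ler_norml => /andP[lim1 lim2].
near=> r.
have : (count_in_ball (visible S) r)%:R / ball_volume R m r <=
       (count_in_ball [set z | sieve m S k.+1 z] r)%:R / ball_volume R m r.
  rewrite ler_wpM2r ?invr_ge0 ?ball_volume_ge0// ler_nat.
  apply: fsubset_leq_card; apply/fsubsetP => z /mem_count_in_ball[vz zr].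
  by apply/mem_count_in_ball; split => //; exact: visible_sieve.
have : (count_in_ball [set z | sieve m S k.+1 z] r)%:R / ball_volume R m r -
    K / k%:R <= (count_in_ball (visible S) r)%:R / ball_volume R m r.
  by near: r; exact: count_sieve_sub_visible.
have : euler_product R S k.+1 - e / 3 <=
      (count_in_ball [set z | sieve m S k.+1 z] r)%:R / ball_volume R m r <=
    euler_product R S k.+1 + e / 3.
  by near: r; exact: count_sieve_density.
rewrite -/(ball_volume R m r) ler_norml => /andP[? ?] ? ?.
by apply/andP; split; lra.
Unshelve. all: by end_near. Qed.
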